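(* Let $q$ be a prime power and $v=q^2+q+1$. Let $D,D'\subseteq\mathbb{Z}/v\mathbb{Z}$ be two perfect difference sets of order $q$, each fixed by the multiplier $q$ (that is, $qD=D$ and $qD'=D'$), and suppose that the projective planes $\pi$ and $\pi'$ described by $D$ and $D'$ are Desarguesian. Then $\pi$ and $\pi'$ can be transformed to one another via a collineation or a correlation; that is, there is either a collineation from $\pi$ to $\pi'$ or a correlation from $\pi$ to $\pi'$.
   Context: Perfect difference set of order $q$: a subset $D\subseteq\mathbb{Z}/v\mathbb{Z}$, $v=q^2+q+1$, with $|D|=q+1$, such that every nonzero element of $\mathbb{Z}/v\mathbb{Z}$ occurs exactly once among the differences $d-d'$ with $d,d'\in D$. The projective plane described by $D$: points are the elements of $\mathbb{Z}/v\mathbb{Z}$, lines are the shifts $j+D$, $j\in\mathbb{Z}/v\mathbb{Z}$, and incidence is membership. A projective plane of order $q$ is Desarguesian if it is (isomorphic to) the plane of one- and two-dimensional subspaces of $\mathbb{F}_q^3$. A collineation is a bijection sending points to points and lines to lines that sends collinear points to collinear points (preserves incidence). A correlation is a bijection $\beta$ from the points and lines of one plane to the points and lines of the other that sends points to lines and lines to points and reverses incidence: if a point $p$ is on a line $\ell$, then the point $\beta(\ell)$ is on the line $\beta(p)$. *)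

(* Defs.v *)
From HB Require Import structures.
From mathcomp Require Import all_boot all_order all_algebra.

Set Implicit Arguments.
Unset Strict Implicit.
Unset Printing Implicit Defensive.

Import GRing.Theory.
Local Open Scope ring_scope.

Definition prime_power (q : nat) : Prop :=
  exists p k : nat, [/\ prime p, (0 < k)%N & q = (p ^ k)%N].

Record incidence_structure : Type := IncidenceStructure {
  point : Type;
  line : Type;
  incident : point -> line -> Prop
}.

(* A bijection of points-and-lines that respects (resp. exchanges) the two    *)
(* sorts is given by its two restrictions.  Between projective planes,        *)
(* bijections that preserve (resp. reverse) incidence also reflect it, so one *)
(* implication suffices.                                                      *)
Definition is_collineation (P P' : incidence_structure)
    (f : point P -> point P') (g : line P -> line P') : Prop :=
  [/\ bijective f, bijective g
    & forall (p : point P) (l : line P),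
        incident p l -> incident (f p) (g l)].

Definition is_correlation (P P' : incidence_structure)
    (f : point P -> line P') (g : line P -> point P') : Prop :=
  [/\ bijective f, bijective g
    & forall (p : point P) (l : line P),
        incident p l -> incident (g l) (f p)].

(* 'Z_n is the ring of integers mod n only for 1 < n, so the definitions      *)
(* below are meaningful for 0 < q.                                            *)
Notation Zmod q := 'Z_(q ^ 2 + q + 1).

Definition perfect_difference_set (q : nat) (D : {set Zmod q}) : Prop :=
  #|D| = q.+1 /\
  forall x : Zmod q, x != 0 ->
    exists! d : Zmod q * Zmod q,
      [/\ d.1 \in D, d.2 \in D & d.1 - d.2 = x].

Definition fixed_by_multiplier (q : nat) (m : nat) (D : {set Zmod q}) : Prop :=
  [set m%:R * d | d in D] = D.

Definition shift (q : nat) (D : {set Zmod q}) (j : Zmod q) : {set Zmod q} :=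
  [set j + d | d in D].

Definition difference_set_plane (q : nat) (D : {set Zmod q}) :
    incidence_structure :=
  @IncidenceStructure
    (Zmod q)
    {L : {set Zmod q} | [exists j : Zmod q, L == shift D j]}
    (fun x L => x \in val L).

Definition subspace_plane (F : fieldType) : incidence_structure :=
  @IncidenceStructure
    {U : {vspace 'rV[F]_3} | \dim U == 1%N}
    {W : {vspace 'rV[F]_3} | \dim W == 2%N}
    (fun U W => (val U <= val W)%VS).

Definition desarguesian (q : nat) (P : incidence_structure) : Prop :=
  exists F : finFieldType, #|F| = q /\
    exists f g, @is_collineation P (subspace_plane F) f g.

(* Main.v *)
Require Import Defs.
From HB Require Import structures.
From mathcomp Require Import all_boot all_order all_algebra.
From mathcomp Require Import all_fingroup all_solvable all_field.

(* Both planes are isomorphic to a plane of subspaces over a field with q     *)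
(* elements.  Finite fields of equal order are isomorphic, and a field        *)
(* isomorphism induces a bijective semilinear map, so the two subspace planes *)
(* are isomorphic; composing gives a collineation.  To invert a collineation  *)
(* known only to preserve incidence, one uses that two points of the source   *)
(* lie on a common line while two points of the target lie on at most one.    *)

Set Implicit Arguments.
Unset Strict Implicit.
Unset Printing Implicit Defensive.

Import GRing.Theory FinRing.Theory.
Local Open Scope ring_scope.

(** The collineation is a composite: from [D]'s plane to the subspace plane over [F], to the one
    over [F'], to the plane of [D']. The middle map applies a field isomorphism to coordinates
    ([finField_isomorphism], [subspace_plane_collineation]). The last one inverts the given
    collineation ([is_collineation_inverse]), using joins in the difference set plane
    ([difference_set_plane_join]) and uniqueness of lines in the subspace plane
    ([subspace_plane_line_unique]). *)

(** The unit group of a finite field is cyclic: for a generator [x], the monomials in [x] already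
    give every nonzero element. *)
Lemma finField_poly_generator (p : nat) (F : finFieldType)
    (pcharFp : p \in [pchar F]) :
  exists x : pPrimeCharType pcharFp, forall z, exists P : {poly 'F_p},
    (map_poly (in_alg (pPrimeCharType pcharFp)) P).[x] = z.
Proof.
have /cyclicP[u Eu] : cyclic [set: {unit F}]%G := field_unit_group_cyclic _.
exists (val u) => z; have [-> | nz_z] := eqVneq z 0.
  by exists 0; rewrite rmorph0 horner0.
have : finField_unit nz_z \in [set: {unit F}] by rewrite inE.
rewrite Eu => /cycleP[n Ez]; exists 'X^n.
by rewrite map_polyXn hornerXn; move/(congr1 val): Ez; rewrite val_unitX.
Qed.

(* The minimal polynomial over F_p of a generator of F divides X^q - X, which *)
(* splits in F'; sending the generator to a root in F' defines the morphism.  *)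
Lemma finField_rmorphism (p : nat) (F F' : finFieldType) :
  p \in [pchar F] -> p \in [pchar F'] -> #|F| = #|F'| ->
  inhabited {rmorphism F -> F'}.
Proof.
move=> pcharF pcharF' eqFF'.
have [x genx] := finField_poly_generator pcharF.
pose L : splittingFieldType 'F_p := pPrimeCharType pcharF.
pose L' : splittingFieldType 'F_p := pPrimeCharType pcharF'.
pose ev (K : splittingFieldType 'F_p) (a : K) (P : {poly 'F_p}) :=
  (map_poly (in_alg K) P).[a].
(* [m] is the minimal polynomial of [x], with its coefficients taken in ['F_p]. *)
have /polyOver1P[m Dm] := minPolyOver 1 (x : L).
have min_m P : ev L x P = 0 -> m %| P.
  move=> Px0; rewrite -(dvdp_map (in_alg L)) -Dm minPoly_dvdp //.
    by apply/polyOver1P; exists P.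
  exact/rootP.
have [y my0] : exists y, ev L' y m = 0.
  have mdvd : m %| 'X^#|F| - 'X.
    apply: min_m; rewrite /ev rmorphB /= map_polyXn map_polyX !hornerE.
    by rewrite (expf_card (x : F)) subrr.
  (* As [F] and [F'] have the same size, the polynomial that [m] divides is the product of all
     ['X - z] over [F']. *)
  have : map_poly (in_alg L') m %| \prod_(z : F') ('X - (z : L')%:P).
    rewrite -[X in _ %| X](finField_genPoly F') -eqFF'.
    by rewrite -[X in _ %| X - _](map_polyXn (in_alg L'))
               -[X in _ %| _ - X](map_polyX (in_alg L')) -rmorphB dvdp_map.
  case/dvdp_prod_XsubC=> mk Emk.
  (* [m] is not constant, so at least one linear factor survives in the mask and supplies the
     root. *)
  have : size (map_poly (in_alg L') m) != 1%N.
    rewrite size_map_poly -(size_map_poly (in_alg L)) -Dm.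
    by rewrite size_minPoly.
  rewrite (eqp_size Emk).
  case: (mask mk _) Emk => [|y r] Emk; first by rewrite big_nil size_poly1.
  exists y; apply/rootP; rewrite (eqp_root Emk) big_cons rootM.
  by rewrite root_XsubC eqxx.
have genx' z : exists P, ev L x P == z.
  by have [P <-] := genx z; exists P.
pose rep z := xchoose (genx' z).
have repK z : ev L x (rep z) = z by apply/eqP/(xchooseP (genx' z)).
(* The value at [y] depends only on the value at [x], since [P - Q] is then a multiple of [m]. Hence
   the arbitrary choice in [rep] is harmless, and [phi] respects sums and products. *)
have evP P Q : ev L x P = ev L x Q -> ev L' y P = ev L' y Q.
  move=> /eqP; rewrite -subr_eq0 /ev -hornerN -hornerD -rmorphB => /eqP /min_m.
  case/dvdpP=> S /(canRL (subrK _)) ->.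
  rewrite /ev rmorphD rmorphM /= hornerD hornerM.
  by rewrite -/(ev L' y m) my0 mulr0 add0r.
pose phi (z : F) : F' := ev L' y (rep z).
have phiB : zmod_morphism phi.
  move=> a b; rewrite /phi.
  rewrite (evP (rep (a - b)) (rep a - rep b)) ?repK.
    by rewrite /ev rmorphB hornerD hornerN.
  by rewrite /ev rmorphB hornerD hornerN -/(ev L x _) -/(ev L x (rep b)) !repK.
have phiM : monoid_morphism phi.
  split=> [|a b]; rewrite /phi.
    by rewrite (evP (rep 1) 1) ?repK /ev rmorph1 hornerC.
  rewrite (evP (rep (a * b)) (rep a * rep b)) ?repK.
    by rewrite /ev rmorphM hornerM.
  by rewrite /ev rmorphM hornerM -/(ev L x _) -/(ev L x (rep b)) !repK.
pose phiA := GRing.isZmodMorphism.Build F F' phi phiB.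
pose phiMm := GRing.isMonoidMorphism.Build F F' phi phiM.
exact: (inhabits (HB.pack phi phiA phiMm : {rmorphism F -> F'})).
Qed.

(** A morphism of fields is injective, hence bijective between finite sets of equal size. *)
Lemma finField_isomorphism (p : nat) (F F' : finFieldType) :
  p \in [pchar F] -> p \in [pchar F'] -> #|F| = #|F'| ->
  exists (phi : {rmorphism F -> F'}) (psi : {rmorphism F' -> F}),
    cancel phi psi /\ cancel psi phi.
Proof.
move=> pcharF pcharF' eqFF'.
have [phi] := finField_rmorphism pcharF pcharF' eqFF'.
have [|psi phiK psiK] := @inj_card_bij _ _ phi (fmorph_inj phi).
  by rewrite eqFF'.
pose psiA := GRing.isZmodMorphism.Build F' F psi (can2_zmod_morphism phiK psiK).
pose psiM :=
  GRing.isMonoidMorphism.Build F' F psi (can2_monoid_morphism phiK psiK).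
by exists phi, (HB.pack psi psiA psiM : {rmorphism F' -> F}).
Qed.

(** The coordinatewise map is only [phi]-semilinear, so the image of [U] is encoded as the span of
    the image of a basis. *)
Definition map_vspace (F F' : fieldType) (phi : {rmorphism F -> F'}) (n : nat)
    (U : {vspace 'rV[F]_n}) : {vspace 'rV[F']_n} :=
  <<map (map_mx phi) (vbasis U)>>%VS.

Lemma memv_map_span (F F' : fieldType) (phi : {rmorphism F -> F'}) (n : nat)
    (X : seq 'rV[F]_n) (v : 'rV[F]_n) :
  v \in <<X>>%VS -> map_mx phi v \in <<map (map_mx phi) X>>%VS.
Proof.
rewrite -[X in <<X>>%VS]/(tval (in_tuple X)) => /coord_span ->.
rewrite raddf_sum rpred_sum // => i _ /=.
rewrite map_mxZ rpredZ // memv_span // map_f //.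
by rewrite -[X in _ \in X]/(tval (in_tuple X)) mem_nth /=.
Qed.

Lemma memv_map_vspace (F F' : fieldType) (phi : {rmorphism F -> F'}) (n : nat)
    (U : {vspace 'rV[F]_n}) (v : 'rV[F]_n) :
  v \in U -> map_mx phi v \in map_vspace phi U.
Proof. by rewrite -{1}(span_basis (vbasisP U)) => /memv_map_span; apply. Qed.

Lemma map_vspaceS (F F' : fieldType) (phi : {rmorphism F -> F'}) (n : nat)
    (U W : {vspace 'rV[F]_n}) :
  (U <= W)%VS -> (map_vspace phi U <= map_vspace phi W)%VS.
Proof.
move=> /subvP UW; apply/span_subvP => _ /mapP[u Uu ->].
by rewrite memv_map_vspace ?UW ?vbasis_mem.
Qed.

Lemma map_vspaceK (F F' : fieldType) (phi : {rmorphism F -> F'})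
    (psi : {rmorphism F' -> F}) (n : nat) :
  cancel phi psi -> cancel (@map_vspace F F' phi n) (@map_vspace F' F psi n).
Proof.
move=> phiK U.
have mapK_mx : cancel (map_mx phi : 'rV_n -> 'rV_n) (map_mx psi).
  by move=> v; apply/rowP=> i; rewrite !mxE phiK.
apply/eqP; rewrite eqEsubv; apply/andP; split.
  apply/span_subvP => _ /mapP[w /vbasis_mem /(memv_map_span psi) Uw ->].
  by move: Uw; rewrite (mapK mapK_mx) (span_basis (vbasisP U)).
by apply/subvP=> u Uu; rewrite -[u]mapK_mx !memv_map_vspace.
Qed.

Lemma dimv_map_vspace_leq (F F' : fieldType) (phi : {rmorphism F -> F'})
    (n : nat) (U : {vspace 'rV[F]_n}) :
  (\dim (map_vspace phi U) <= \dim U)%N.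
Proof. by apply: leq_trans (dim_span _) _; rewrite size_map size_tuple. Qed.

(** Neither [phi] nor [psi] raises dimensions, and [psi] recovers [U]. *)
Lemma dimv_map_vspace (F F' : fieldType) (phi : {rmorphism F -> F'})
    (psi : {rmorphism F' -> F}) (n : nat) (U : {vspace 'rV[F]_n}) :
  cancel phi psi -> \dim (map_vspace phi U) = \dim U.
Proof.
move=> phiK; apply/eqP; rewrite eqn_leq dimv_map_vspace_leq /=.
by rewrite -{1}(map_vspaceK phiK U) dimv_map_vspace_leq.
Qed.

Lemma subspace_plane_collineation (F F' : fieldType)
    (phi : {rmorphism F -> F'}) (psi : {rmorphism F' -> F}) :
  cancel phi psi -> cancel psi phi ->
  exists f g, @is_collineation (subspace_plane F) (subspace_plane F') f g.
Proof.
move=> phiK psiK.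
have dphi (k : nat) (U : {U : {vspace 'rV[F]_3} | \dim U == k}) :
  \dim (map_vspace phi (val U)) == k.
  by rewrite (dimv_map_vspace _ phiK) (valP U).
have dpsi (k : nat) (U : {U : {vspace 'rV[F']_3} | \dim U == k}) :
  \dim (map_vspace psi (val U)) == k.
  by rewrite (dimv_map_vspace _ psiK) (valP U).
pose h k U := exist (fun W : {vspace 'rV[F']_3} => \dim W == k) _ (dphi k U).
have bij_h k : bijective (h k).
  exists (fun U => exist (fun W => \dim W == k) _ (dpsi k U)) => U;
    by apply: val_inj; apply: map_vspaceK.
exists (h 1%N), (h 2%N).
by split; [exact: bij_h | exact: bij_h | move=> U W /=; exact: map_vspaceS].
Qed.

Lemma is_collineation_comp (P Q S : incidence_structure)
    (f : point P -> point Q) (g : line P -> line Q)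
    (f' : point Q -> point S) (g' : line Q -> line S) :
  is_collineation f g -> is_collineation f' g' ->
  is_collineation (f' \o f) (g' \o g).
Proof.
case=> bf bg fg [bf' bg' fg']; split; [exact: bij_comp | exact: bij_comp |].
by move=> x l /fg /fg'.
Qed.

Lemma is_collineation_inverse (P Q : incidence_structure)
    (f : point P -> point Q) (g : line P -> line Q) :
  (forall (x : point P) (l : line P), exists a, x <> a /\ incident a l) ->
  (forall x y : point P, x <> y -> exists l, incident x l /\ incident y l) ->
  (forall (x y : point Q) (l m : line Q), x <> y ->
     incident x l -> incident y l -> incident x m -> incident y m -> l = m) ->
  is_collineation f g -> exists f' g', @is_collineation Q P f' g'.
Proof.
move=> other_point joinP uniqQ [bf bg fg].
(* Take another point [a] on [l] and a line [m] through [x] and [a]. Both [g m] and [g l] pass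
   through the distinct points [f x] and [f a], so [m = l]. *)
have reflects x l : incident (f x) (g l) -> incident x l.
  move=> fxl; have [a [xa al]] := other_point x l.
  have [m [xm am]] := joinP x a xa.
  suff <- : m = l by [].
  apply: (bij_inj bg); apply: (uniqQ (f x) (f a)) => //; try exact: fg.
  by move/(bij_inj bf).
have [f' fK f'K] := bf; have [g' gK g'K] := bg.
exists f', g'; split; [by exists f | by exists g | move=> y m ym].
by apply: reflects; rewrite f'K g'K.
Qed.

Lemma subspace_plane_line_unique (F : fieldType)
    (x y : point (subspace_plane F)) (l m : line (subspace_plane F)) :
  x <> y -> incident x l -> incident y l -> incident x m -> incident y m ->
  l = m.
Proof.
case: x y l m => [x dx] [y dy] [l dl] [m dm] /= nxy xl yl xm ym.
apply: val_inj => /=.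
have nxy' : ~~ (y <= x)%VS.
  apply/negP=> yx; apply: nxy; apply: val_inj => /=; apply/esym/eqP.
  by rewrite eqEdim yx (eqP dx) (eqP dy).
(* Distinct one-dimensional subspaces have a sum of dimension at least two, so a two-dimensional
   subspace containing both equals the sum. *)
have dxy : (1 < \dim (x + y)%VS)%N.
  rewrite -[X in (X < _)%N](eqP dx) ltnNge; apply: contra nxy' => le.
  have /eqP -> : x == (x + y)%VS by rewrite eqEdim addvSl.
  exact: addvSr.
have span k : \dim k == 2%N -> (x <= k)%VS -> (y <= k)%VS -> (x + y)%VS = k.
  move=> dk xk yk; apply/eqP.
  by rewrite eqEdim (eqP dk) dxy andbT subv_add xk.
by rewrite -(span l) // (span m).
Qed.

Lemma difference_set_plane_other_point (q : nat) (D : {set Zmod q})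
    (x : point (difference_set_plane D)) (l : line (difference_set_plane D)) :
  (0 < q)%N -> #|D| = q.+1 -> exists a, x <> a /\ incident a l.
Proof.
case: l => L PL /= q_gt0 cardD; have /existsP[j /eqP EL] := PL.
have cardL : #|L| = q.+1 by rewrite EL card_imset //; apply: addrI.
have /card_gt0P[a] : (0 < #|L :\ x|)%N.
  by rewrite -(ltn_add2l (x \in L)) -cardsD1 cardL addn0; case: (x \in L).
by rewrite !inE => /andP[/eqP nax aL]; exists a; split=> // xa; apply: nax.
Qed.

Lemma difference_set_plane_join (q : nat) (D : {set Zmod q})
    (x y : point (difference_set_plane D)) :
  perfect_difference_set D -> x <> y ->
  exists l : line (difference_set_plane D), incident x l /\ incident y l.
Proof.
move=> [_ diffD] /eqP nxy.
have [|[d e] /= [[dD eD Exy] _]] := diffD (x - y); first by rewrite subr_eq0.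
(* From [x - y = d - e] follows [x - d = y - e], so the shift by this element contains both [x] and
   [y]. *)
have PL : [exists j, shift D (x - d) == shift D j].
  by apply/existsP; exists (x - d).
exists (exist (fun L => [exists j, L == shift D j]) _ PL) => /=; split; apply/imsetP.
  by exists d; rewrite ?subrK.
by exists e => //; rewrite -[d](subrK e) Exy opprD addrA subKr subrK.
Qed.

Theorem theorem2p8 (q : nat) (D D' : {set Zmod q}) :
  prime_power q ->
  perfect_difference_set D ->
  perfect_difference_set D' ->
  fixed_by_multiplier q D ->
  fixed_by_multiplier q D' ->
  desarguesian q (difference_set_plane D) ->
  desarguesian q (difference_set_plane D') ->
  (exists f g,
     @is_collineation (difference_set_plane D) (difference_set_plane D') f g) \/
  (exists f g,
     @is_correlation (difference_set_plane D) (difference_set_plane D') f g).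
Proof.
move=> [p [k [p_pr k_gt0 Eq]]] _ pdsD' _ _ [F [cardF [f [g fgP]]]].
move=> [F' [cardF' [f' [g' fgP']]]]; left.
have q_gt0 : (0 < q)%N by rewrite Eq expn_gt0 prime_gt0.
have pcharF : p \in [pchar F] by apply: (@card_finPcharP _ _ k); rewrite ?cardF.
have pcharF' : p \in [pchar F'].
  by apply: (@card_finPcharP _ _ k); rewrite ?cardF'.
have [|phi [psi [phiK psiK]]] := finField_isomorphism pcharF pcharF'.
  by rewrite cardF.
have [h [i hiP]] := subspace_plane_collineation phiK psiK.
have [f1 [g1 fg1P]] : exists f1 g1,
    @is_collineation (subspace_plane F') (difference_set_plane D') f1 g1.
  apply: is_collineation_inverse fgP'.
  - move=> x l; apply: difference_set_plane_other_point => //; exact: pdsD'.1.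
  - by move=> x y; apply: difference_set_plane_join.
  - exact: subspace_plane_line_unique.
exists (f1 \o (h \o f)), (g1 \o (i \o g)).
exact: is_collineation_comp (is_collineation_comp fgP hiP) fg1P.
Qed.
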